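(* Let $n\in\mathbb{N}$, $n\ge 1$, let $0<\alpha\le 1$, and let $\gamma=(\gamma_1,\dots,\gamma_n)\in\mathbb{R}^n$ satisfy $$0\le\gamma_k\quad\text{and}\quad \alpha+s_k\le k,\qquad k=1,2,\dots,n,\qquad\text{where } s_k:=\sum_{i=1}^k\gamma_i .$$ Then, on the space $$X_{FT}=\{f\in L_1(0,1):\ I^{\alpha}f\in \mathrm{AC}([0,1])\ \text{and}\ (I^{\alpha}f)(0)=0\},$$ the $n$th level fractional derivative $D^{\alpha,(\gamma)}_{nL}$ of order $\alpha$ and type $\gamma$ is a left-inverse operator to the Riemann-Liouville fractional integral $I^\alpha$, i.e., for every $f\in X_{FT}$, $$(D^{\alpha,(\gamma)}_{nL}\, I^\alpha f)(x)=f(x),\qquad x\in[0,1].$$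
   Context: Functions in $L_1(0,1)$ are identified when equal almost everywhere; equalities between them (including the one in the claim) are understood in $L_1(0,1)$, i.e. for a.e. $x\in[0,1]$. For $\alpha\ge 0$ and $f\in L_1(0,1)$, the Riemann-Liouville fractional integral is $$(I^\alpha f)(x)=\frac{1}{\Gamma(\alpha)}\int_0^x (x-t)^{\alpha-1}f(t)\,dt\quad(\alpha>0),\qquad (I^0f)(x)=f(x).$$ $\mathrm{AC}([0,1])$ is the space of absolutely continuous functions on $[0,1]$: $f\in\mathrm{AC}([0,1])$ iff there is $\phi\in L_1(0,1)$ with $f(x)=f(0)+\int_0^x\phi(t)\,dt$ for $x\in[0,1]$. For such $f$ the first order derivative is defined by $\frac{df}{dx}:=\phi\in L_1(0,1)$. For an element $h$ of $L_1(0,1)$, ''$h\in\mathrm{AC}([0,1])$'' means that $h$ has an absolutely continuous representative, and then $h(0)$ denotes the value of this representative at $0$. The $n$th level fractional derivative of order $\alpha$ and type $\gamma=(\gamma_1,\dots,\gamma_n)$ is the operator $D^{\alpha,(\gamma)}_{nL}:X^1_{nL}\to L_1(0,1)$, $$(D^{\alpha,(\gamma)}_{nL} f)(x)=\left(\prod_{k=1}^n\Big(I^{\gamma_k}\,\frac{d}{dx}\Big)\right)(I^{n-\alpha-s_n}f)(x),$$ where products of operators are compositions ordered from left to right with increasing index, i.e. $\prod_{k=1}^n(I^{\gamma_k}\frac{d}{dx})=I^{\gamma_1}\frac{d}{dx}\,I^{\gamma_2}\frac{d}{dx}\cdots I^{\gamma_n}\frac{d}{dx}$ (so the factor with $k=n$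 is applied first), and an empty product is the identity operator. Its domain is $$X^1_{nL}=\left\{f\in L_1(0,1):\ \left(\prod_{k=i}^n\Big(I^{\gamma_k}\,\frac{d}{dx}\Big)\right)I^{n-\alpha-s_n}f\in\mathrm{AC}([0,1]),\ i=2,\dots,n+1\right\}.$$ *)

(* Defs.v *)
From mathcomp Require Import all_boot all_order all_algebra.
From mathcomp Require Import all_classical all_reals all_analysis.
Set Implicit Arguments.
Unset Strict Implicit.
Unset Printing Implicit Defensive.
Import Order.TTheory GRing.Theory Num.Theory.
Import numFieldNormedType.Exports.
Local Open Scope classical_set_scope.
Local Open Scope ring_scope.

(* An element of L_1(0,1) is represented by a total function R -> R that is
   integrable on [0,1]; its values outside [0,1] are irrelevant.  Equality in
   L_1(0,1) is [eqL1].  All notions below about elements of L_1(0,1) are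
   stated through representatives and do not depend on their choice. *)

Section FractionalCalculus.
Variable R : realType.
Implicit Types (f g h phi F : R -> R) (a alpha : R).

Local Notation mu := (@lebesgue_measure R).

Definition L1 f : Prop := mu.-integrable `[0, 1] (EFin \o f).

Definition eqL1 f g : Prop := f = g %[ae mu in `[0, 1]%classic].

(* Euler's Gamma function, for a > 0. *)
Definition Gamma a : R :=
  \int[mu]_(t in `]0, +oo[) (t `^ (a - 1) * expR (- t)).

(* Riemann-Liouville integral of order a >= 0.  For a > 0 and f in L_1(0,1) the
   integrand is integrable on [0, x] for a.e. x in [0,1], so that the real-valued
   integral is the genuine one for a.e. x. *)
Definition RLint a f : R -> R :=
  if a == 0 then f
  else fun x => (Gamma a)^-1 * \int[mu]_(t in `[0, x]) ((x - t) `^ (a - 1) * f t).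

Definition AC_with_derivative F phi : Prop :=
  L1 phi /\
  forall x : R, x \in `[0, 1] -> F x = F 0 + \int[mu]_(t in `[0, x]) phi t.

Definition AC F : Prop := exists phi, AC_with_derivative F phi.

(* F is an absolutely continuous representative of the class of h; it is
   unique on [0,1]. *)
Definition AC_representative h F : Prop := AC F /\ eqL1 h F.

Definition inAC h : Prop := exists F, AC_representative h F.

(* First order derivative of h in AC([0,1]).  It is determined up to eqL1, and a
   function is selected by choice; the value is meaningless when ~ inAC h. *)
Definition ddx h : R -> R :=
  xget (cst 0) [set phi | exists F, eqL1 h F /\ AC_with_derivative F phi].

Section NthLevel.
Variables (n : nat) (alpha : R) (gamma : 'rV[R]_n).

(* The entry gamma_k, k = 1, ..., n, is gamma 0 j with j : 'I_n and k = j.+1. *)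
Definition psum (k : nat) : R := \sum_(j < n | (j < k)%N) gamma 0 j.

(* Composition of the operators I^{gamma_k} d/dx for k = i, ..., n, the factor
   with k = n being applied first. *)
Definition prod_from (i : nat) : (R -> R) -> (R -> R) :=
  \big[@comp (R -> R) (R -> R) (R -> R) / idfun]_(j < n | (i <= j.+1)%N)
     (RLint (gamma 0 j) \o ddx).

Definition X1nL f : Prop :=
  L1 f /\
  forall i, (2 <= i <= n.+1)%N ->
    inAC (prod_from i (RLint (n%:R - alpha - psum n) f)).

(* The nth level fractional derivative; meaningful on the domain X1nL. *)
Definition DnL f : R -> R := prod_from 1 (RLint (n%:R - alpha - psum n) f).

End NthLevel.

Definition XFT alpha f : Prop :=
  L1 f /\ exists F, AC_representative (RLint alpha f) F /\ F 0 = 0.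

End FractionalCalculus.

(* Main.v *)
Require Import Defs.
From HB Require Import structures.
From mathcomp Require Import all_boot all_order all_algebra.
From mathcomp Require Import all_classical all_reals all_analysis.
From mathcomp Require Import measurable_realfun ring.
Set Implicit Arguments.
Unset Strict Implicit.
Unset Printing Implicit Defensive.
Import Order.TTheory GRing.Theory Num.Theory.
Import numFieldNormedType.Exports.
Local Open Scope classical_set_scope.
Local Open Scope ring_scope.

(* For f in X_FT write I^alpha f = I^1 phi with phi in L_1, and put
   c_k = k - alpha - s_k >= 0.  By the semigroup law, after the factors
   n, ..., k + 1 have been applied to I^(n - alpha - s_n) I^alpha f one has
   I^1 I^(c_k) phi: the next d/dx removes I^1, and I^(gamma_k) turns I^(c_k) phi
   into I^(1 + c_(k - 1)) phi.  At the end I^(1 - alpha) phi remains, and this is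
   f because both have the same image under I^1.

   The semigroup law is the associativity of the convolution (Fubini) together
   with B(a, b) = Gamma(a) Gamma(b) / Gamma(a + b); that d/dx inverts I^1 in L_1
   is Lebesgue's differentiation theorem. *)

(** * Lebesgue measure and integrals under affine maps *)

Section LebesgueAffine.
Context {R : realType}.
Notation mu := (@lebesgue_measure R).
Implicit Types (k c : R).

Let affine k c (x : measurableTypeR R) : measurableTypeR R := k * (x : R) + c.

Let measurable_affine k c : measurable_fun [set: measurableTypeR R] (affine k c).
Proof.
by apply: measurable_funD => //; exact: measurable_funM.
Qed.

Local Open Scope ereal_scope.

(** By uniqueness of Lebesgue measure: the pushforward under the affine map, scaled by [k], gives
    half-open intervals their length. *)
Lemma lebesgue_measure_affine k c (k0 : (0 < k)%R) (A : set R) :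
  measurable A -> mu A = k%:E * mu (affine k c @^-1` A).
Proof.
move=> mA.
pose m : {measure set (measurableTypeR R) -> \bar R} :=
  mscale (NngNum (ltW k0)) (pushforward mu (affine k c)).
rewrite (@lebesgue_measure_unique R (m (@measurable_affine k c)))// => X /ocitvP[->|[[a b]/= ab ->]].
  by rewrite !measure0.
have -> : m (@measurable_affine k c) `]a, b]%classic =
    k%:E * mu `](a - c) / k, (b - c) / k]%classic%R.
  rewrite /m /mscale /pushforward; congr (_ * mu _).
  apply/seteqP; split => x /=; rewrite !in_itv/= /affine => /andP[h1 h2].
    by rewrite ltr_pdivrMr// ler_pdivlMr// ltrBlDr lerBrDr mulrC h1 h2.
by move: h1 h2; rewrite ltr_pdivrMr// ler_pdivlMr// ltrBlDr lerBrDr mulrC => -> ->.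
rewrite !lebesgue_measure_itv/= !lte_fin ab ltr_pM2r ?invr_gt0// ltrD2r ab.
by rewrite -!EFinD -EFinM; congr (_ %:E); field; rewrite gt_eqF.
Qed.

Lemma ge0_integral_affine k c (f : R -> \bar R) : (0 < k)%R ->
  measurable_fun setT f -> (forall x, 0 <= f x) ->
  \int[mu]_x f x = k%:E * \int[mu]_x f (k * x + c)%R.
Proof.
move=> k0 mf f0; pose kn := NngNum (ltW k0).
pose m : {measure set (measurableTypeR R) -> \bar R} :=
  pushforward mu (affine k c).
transitivity (\int[mscale kn (m (@measurable_affine k c))]_x f x).
  by apply: eq_measure_integral => A mA _; exact: lebesgue_measure_affine.
rewrite ge0_integral_mscale//=; congr (_ * _).
by rewrite ge0_integral_pushforward//; exact: measurable_affine.
Qed.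

(** Positive and negative parts are translated separately, so the formula also covers integrals that
    are infinite or of the form oo - oo. *)
Lemma integral_translation c (f : R -> \bar R) : measurable_fun setT f ->
  \int[mu]_x f (x + c)%R = \int[mu]_x f x.
Proof.
move=> mf; rewrite [LHS]integralE [RHS]integralE; congr (_ - _).
- rewrite [RHS](@ge0_integral_affine 1 c)//; last exact: measurable_funepos.
  rewrite mul1e; under [RHS]eq_integral do rewrite mul1r.
  by apply: eq_integral => x _; rewrite 2!funeposE.
- rewrite [RHS](@ge0_integral_affine 1 c)//; last exact: measurable_funeneg.
  rewrite mul1e; under [RHS]eq_integral do rewrite mul1r.
  by apply: eq_integral => x _; rewrite 2!funenegE.
Qed.

End LebesgueAffine.

(** * Convolution of integrable functions *)

Section RealIntegral.
Context d (T : measurableType d) (R : realType).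
Variable mu : {measure set T -> \bar R}.

Lemma integrable_fine (f : T -> \bar R) :
  mu.-integrable setT f -> mu.-integrable setT (EFin \o (fine \o f)).
Proof.
move=> fi; have mf := measurable_int _ fi.
apply: (le_integrable _ _ _ fi) => //.
  by apply/measurable_EFinP; apply: measurableT_comp mf => //; exact: fine_measurable.
by move=> x _ /=; case: (f x) => [r| |]//=; rewrite normr0 leey.
Qed.

Lemma integral_fine (f : T -> \bar R) : mu.-integrable setT f ->
  (\int[mu]_x f x = \int[mu]_x (fine (f x))%:E)%E.
Proof.
move=> fi; apply: ae_eq_integral => //.
- exact: measurable_int fi.
- exact: measurable_int (integrable_fine fi).
- have := integrable_ae measurableT fi.
  by apply: filterS => x /(_ Logic.I) fx _ /=; rewrite fineK.
Qed.

Lemma Rintegral_eq0 (f : T -> R) : f =1 cst 0 -> \int[mu]_x f x = 0.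
Proof.
move=> f0; rewrite (eq_Rintegral _ (g := cst 0)); last by move=> x _; exact: f0.
by rewrite /Rintegral integral0.
Qed.

(** One of the two parts of [f] has infinite integral, so the extended integral is infinite (oo - oo
    being -oo), and [fine] sends it to 0. *)
Lemma Rintegral_nonintegrable (f : T -> R) : measurable_fun setT f ->
  ~ mu.-integrable setT (EFin \o f) -> \int[mu]_x f x = 0.
Proof.
move=> mf nf; rewrite /Rintegral integralE.
have mEf : measurable_fun setT (EFin \o f) by exact/measurable_EFinP.
have p0 := integral_ge0 mu (fun x (_ : setT x) => funepos_ge0 (EFin \o f) x).
have n0 := integral_ge0 mu (fun x (_ : setT x) => funeneg_ge0 (EFin \o f) x).
case: (ltP (\int[mu]_x (EFin \o f)^\+ x) +oo)%E => hp; last first.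
  rewrite leye_eq in hp; rewrite (eqP hp).
  by case: (\int[mu]_x (EFin \o f)^\- x)%E.
case: (ltP (\int[mu]_x (EFin \o f)^\- x) +oo)%E => hn; last first.
  by rewrite leye_eq in hn; rewrite (eqP hn) addeNy.
exfalso; apply: nf; apply/integrableP; split => //.
rewrite (eq_integral ((EFin \o f)^\+ \+ (EFin \o f)^\-)%E); last first.
  by move=> x _; rewrite -[LHS]/((abse \o (EFin \o f)) x) fune_abse.
rewrite ge0_integralD//; [exact: lte_add_pinfty| |].
  exact: measurable_funepos.
exact: measurable_funeneg.
Qed.

(** Serves at points where integrability is unknown: scaling by [c != 0] preserves
    non-integrability, and then both sides take the default value 0. *)
Lemma measurable_RintegralZl (c : R) (f : T -> R) : measurable_fun setT f ->
  \int[mu]_x (c * f x) = c * \int[mu]_x f x.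
Proof.
move=> mf; have [->|c0] := eqVneq c 0.
  by rewrite mul0r Rintegral_eq0// => x; rewrite mul0r.
have [fi|nfi] := pselect (mu.-integrable setT (EFin \o f)).
  exact: RintegralZl.
rewrite (Rintegral_nonintegrable mf nfi) mulr0 Rintegral_nonintegrable//.
  exact: measurable_funM.
move=> /(integrableZl measurableT c^-1) ci; apply: nfi.
by apply: eq_integrable ci => // x _ /=; rewrite -EFinM mulKf.
Qed.

Lemma ae_eq_Rintegral (D : set T) (f g : T -> R) : measurable D ->
  measurable_fun D f -> measurable_fun D g -> f = g %[ae mu in D] ->
  \int[mu]_(x in D) f x = \int[mu]_(x in D) g x.
Proof.
move=> mD mf mg fg; rewrite /Rintegral; congr fine.
apply: ae_eq_integral => //; [exact/measurable_EFinP..|].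
by apply: filterS fg => x /= h /h ->.
Qed.

End RealIntegral.

Section Convolution.
Context {R : realType}.
Notation mu := (@lebesgue_measure R).
Implicit Types (k l f : R -> R).

Local Open Scope ereal_scope.

Lemma measurable_convolution_integrand (k g : R -> \bar R) :
  measurable_fun setT k -> measurable_fun setT g ->
  measurable_fun [set: R * R] (fun z => k (z.1 - z.2)%R * g z.2).
Proof.
move=> mk mg; apply: emeasurable_funM; last exact: measurableT_comp.
by apply: measurableT_comp => //; exact: measurable_funB.
Qed.

(** Tonelli: with the integral in [x] done first, translation invariance makes the integral of
    [k (x - t)] independent of [t]. *)
Lemma ge0_integral_convolution (k g : R -> \bar R) :
  measurable_fun setT k -> measurable_fun setT g ->
  (forall x, 0 <= k x) -> (forall x, 0 <= g x) ->
  \int[mu]_x \int[mu]_t (k (x - t)%R * g t) = \int[mu]_x k x * \int[mu]_x g x.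
Proof.
move=> mk mg k0 g0.
rewrite (@fubini_tonelli _ _ _ _ _ mu mu (fun z : R * R => k (z.1 - z.2)%R * g z.2))//=; first last.
- by move=> z; exact: mule_ge0.
- exact: measurable_convolution_integrand.
rewrite -ge0_integralZl//; last exact: integral_ge0.
apply: eq_integral => t _; rewrite ge0_integralZr//; last first.
  by apply: measurableT_comp => //; exact: measurable_funB.
by rewrite (integral_translation (- t)%R).
Qed.

Lemma integrable_convolution_integrand k f :
  mu.-integrable setT (EFin \o k) -> mu.-integrable setT (EFin \o f) ->
  (mu \x mu).-integrable [set: R * R] (fun z => (k (z.1 - z.2) * f z.2)%:E).
Proof.
move=> /integrableP[mk ik] /integrableP[mf jf].
have mkf : measurable_fun [set: R * R] (fun z => (k (z.1 - z.2) * f z.2)%:E).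
  under eq_fun do rewrite EFinM.
  exact: (@measurable_convolution_integrand (EFin \o k) (EFin \o f)).
apply/integrable12ltyP => //=.
under eq_integral do under eq_integral do rewrite normrM EFinM.
rewrite (@ge0_integral_convolution (abse \o (EFin \o k)) (abse \o (EFin \o f)))//=;
  [|exact: measurableT_comp..].
by apply: lte_mul_pinfty => //; [exact: integral_ge0|rewrite ge0_fin_numE// integral_ge0].
Qed.

End Convolution.

Section RealConvolution.
Context {R : realType}.
Notation mu := (@lebesgue_measure R).
Implicit Types (k l f : R -> R).

Definition convolution k f (x : R) : R := \int[mu]_t (k (x - t) * f t).

Lemma integrable_convolution k f :
  mu.-integrable setT (EFin \o k) -> mu.-integrable setT (EFin \o f) ->
  mu.-integrable setT (EFin \o convolution k f).
Proof.
move=> ki fi.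
exact: integrable_fine (integrable_fubini_F (integrable_convolution_integrand ki fi)).
Qed.

Lemma integrable_fubini_G (h : R * R -> \bar R) :
  (mu \x mu)%E.-integrable setT h -> mu.-integrable setT (fubini_G mu h).
Proof.
move=> hi; have mh := measurable_int _ hi.
have mah : measurable_fun [set: R * R] (abse \o h) by exact: measurableT_comp.
apply/integrableP; split; first exact: measurable_fubini_G hi.
apply: le_lt_trans ((integrable21ltyP mu mu mh).1 hi).
apply: ge0_le_integral => //.
- exact: measurableT_comp (measurable_fubini_G hi).
- by apply: (measurable_fun_fubini_tonelli_G (m1 := mu) (abse \o h)) => // z; exact: abse_ge0.
- move=> y _; apply: le_abse_integral => //.
  exact: measurableT_comp.
Qed.

Lemma Fubini_Rintegral (h : R * R -> R) :
  (mu \x mu)%E.-integrable setT (EFin \o h) ->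
  \int[mu]_x \int[mu]_y h (x, y) = \int[mu]_y \int[mu]_x h (x, y).
Proof.
move=> hi; have := Fubini hi.
rewrite integral_fine; last exact: integrable_fubini_F hi.
by rewrite [in X in _ = X -> _]integral_fine//; [move=> /(congr1 fine)|exact: integrable_fubini_G hi].
Qed.

(** The threefold convolution of the absolute values is integrable, hence finite at almost every
    [x]; at such an [x], Fubini exchanges the two inner integrations. *)
Lemma convolution_assoc k l f :
  mu.-integrable setT (EFin \o k) -> mu.-integrable setT (EFin \o l) ->
  mu.-integrable setT (EFin \o f) ->
  {ae mu, forall x, convolution k (convolution l f) x = convolution (convolution k l) f x}.
Proof.
move=> ki li fi.
have [/integrableP[mk' kfin] /integrableP[ml' lfin] /integrableP[mf' ffin]] :=
  And3 ki li fi.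
have mk : measurable_fun setT k by exact/measurable_EFinP.
have ml : measurable_fun setT l by exact/measurable_EFinP.
have mf : measurable_fun setT f by exact/measurable_EFinP.
pose K t := `|(k t)%:E|%E; pose L t := `|(l t)%:E|%E; pose F t := `|(f t)%:E|%E.
have mK : measurable_fun setT K by exact: measurableT_comp.
have mL : measurable_fun setT L by exact: measurableT_comp.
have mF : measurable_fun setT F by exact: measurableT_comp.
have K0 t : (0 <= K t)%E by exact: abse_ge0.
have L0 t : (0 <= L t)%E by exact: abse_ge0.
have F0 t : (0 <= F t)%E by exact: abse_ge0.
pose G (t : R) := (\int[mu]_s (L (t - s)%R * F s))%E.
have G0 t : (0 <= G t)%E by apply: integral_ge0 => s _; exact: mule_ge0.
have mG : measurable_fun setT G.
  apply: (@measurable_fun_fubini_tonelli_F _ _ _ _ _ mu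
    (fun z : R * R => (L (z.1 - z.2)%R * F z.2)%E)).
    exact: measurable_convolution_integrand.
  by move=> z; exact: mule_ge0.
pose H (x : R) := (\int[mu]_t (K (x - t)%R * G t))%E.
have H0 x : (0 <= H x)%E by apply: integral_ge0 => s _; exact: mule_ge0.
have mH : measurable_fun setT H.
  apply: (@measurable_fun_fubini_tonelli_F _ _ _ _ _ mu
    (fun z : R * R => (K (z.1 - z.2)%R * G z.2)%E)).
    exact: measurable_convolution_integrand.
  by move=> z; exact: mule_ge0.
have Hfin : mu.-integrable setT H.
  apply/integrableP; split => //.
  under eq_integral do rewrite gee0_abs//.
  rewrite ge0_integral_convolution// ge0_integral_convolution//.
  have p u : (\int[mu]_x `|u x| < +oo)%E -> (\int[mu]_x `|u x|)%E \is a fin_num.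
    by move=> ?; rewrite ge0_fin_numE// integral_ge0.
  apply: lte_mul_pinfty => //; [exact: integral_ge0|exact: p|].
  by apply: lte_mul_pinfty => //; [exact: integral_ge0|exact: p].
have := integrable_ae measurableT Hfin.
apply: filterS => x /(_ Logic.I) Hx.
pose h (z : R * R) := k (x - z.1) * l (z.1 - z.2) * f z.2.
have mh : measurable_fun setT h.
  apply: measurable_funM; last exact: measurableT_comp.
  apply: measurable_funM.
    by apply: measurableT_comp => //; exact: measurable_funB.
  by apply: measurableT_comp => //; exact: measurable_funB.
(* By Tonelli, the double integral of [|h|] is [H x], finite by the choice of [x]. *)
have hi : (mu \x mu)%E.-integrable setT (EFin \o h).
  apply/integrable12ltyP; first exact/measurable_EFinP.
  rewrite (_ : (\int[mu]_x1 _)%E = H x); first by rewrite -ge0_fin_numE.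
  apply: eq_integral => t _; rewrite /G -ge0_integralZl//.
  - by apply: eq_integral => s _; rewrite /h /= /K /L /F -!abseM -!EFinM mulrA.
  - apply: (measurableT_comp (measurable_convolution_integrand mL mF)
      (g := fun s => (t, s))).
    exact: measurable_pair1.
  - by move=> s _; exact: mule_ge0.
transitivity (\int[mu]_t \int[mu]_s h (t, s)).
  apply: eq_Rintegral => t _; rewrite -measurable_RintegralZl.
    by apply: eq_Rintegral => s _; rewrite /h /= mulrA.
  apply: measurable_funM => //.
  by apply: measurableT_comp => //; exact: measurable_funB.
rewrite Fubini_Rintegral//; apply: eq_Rintegral => s _.
rewrite mulrC -measurable_RintegralZl; last first.
  apply: measurable_funM => //.
  by apply: measurableT_comp => //; exact: measurable_funB.
(* Replacing [t] by [t + s] turns [k (x - t) * l (t - s)] into [k (x - s - t) * l t], the integrand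
   of the convolution of [k] and [l] at [x - s]. *)
rewrite /Rintegral -(integral_translation s); last first.
  apply/measurable_EFinP; apply: measurable_funM => /=; last exact: measurable_cst.
  apply: measurable_funM => /=.
    by apply: measurableT_comp => //; exact: measurable_funB.
  by apply: measurableT_comp => //; exact: measurable_funB.
congr fine; apply: eq_integral => t _; rewrite /h /=; congr (_ %:E).
by rewrite (_ : x - (t + s) = x - s - t) ?addrK; ring.
Qed.

End RealConvolution.

(** * Gamma and Beta integrals *)

Section GammaFunction.
Context {R : realType}.
Notation mu := (@lebesgue_measure R).
Implicit Types (a b t u x : R).

Local Open Scope ereal_scope.

Lemma continuous_powR a x : (0 < x)%R -> {for x, continuous (fun t : R => t `^ a)%R}.
Proof.
move=> x0; apply: differentiable_continuous; apply/derivable1_diffP.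
by apply: derivable_powR; rewrite in_itv/= x0.
Qed.

(** Exhaust ]0, 1] by the intervals [1/(n+1), 1]; on each of them the primitive t^a / a bounds the
    integral by 1/a. *)
Lemma integral_powR_le a : (0 < a)%R ->
  \int[mu]_(t in `]0%R, 1%R]) (t `^ (a - 1))%:E <= (a^-1)%:E.
Proof.
move=> a0.
pose F n : set R := `[n.+1%:R^-1%R, 1%R]%classic.
have UF : \bigcup_n F n = `]0%R, 1%R]%classic.
  apply/seteqP; split => x.
    move=> [n _]; rewrite /F /= !in_itv/= => /andP[h ->]; rewrite andbT.
    by rewrite (lt_le_trans _ h)// invr_gt0.
  rewrite /= in_itv/= => /andP[x0 x1].
  exists (Num.truncn x^-1) => //; rewrite /F /= in_itv/= x1 andbT.
  by rewrite invf_ple ?posrE//; apply/ltW/truncnS_gt.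
have cvF : \int[mu]_(t in F n) (t `^ (a - 1))%:E @[n --> \oo] -->
    \int[mu]_(t in \bigcup_n F n) (t `^ (a - 1))%:E.
  apply: ge0_nondecreasing_set_cvg_integral.
  - move=> m n mn; rewrite subsetEset => x; rewrite /F /= !in_itv/= => /andP[h ->].
    rewrite andbT; apply: le_trans h.
    by rewrite lef_pV2 ?posrE// ler_nat ltnS.
  - by move=> n; exact: measurable_itv.
  - move=> n; apply/measurable_EFinP; apply: measurable_funTS.
    exact: measurable_powR.
  - by move=> n x _; rewrite lee_fin powR_ge0.
rewrite -UF -(cvg_lim _ cvF)//; apply: lime_le; first by apply/cvg_ex; eexists; exact: cvF.
near=> n; rewrite /F.
(* A degenerate interval contains at most the point 1 and contributes 0; the fundamental theorem is
   applied only to proper ones. *)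
have [n1|n1] := ltP (n.+1%:R^-1)%R (1%R : R); last first.
  rewrite (@integral_Sset1 _ _ _ 1%R); first by rewrite lee_fin invr_ge0 ltW.
  move=> x; rewrite /= in_itv/= => /andP[h1 h2].
  by apply/eqP; rewrite eq_le h2 (le_trans n1).
have n0 : (0 < n.+1%:R^-1 :> R)%R by rewrite invr_gt0.
have dF x : (0 < x)%R -> is_derive x 1%R (fun t : R => (a^-1 * t `^ a)%R) (x `^ (a - 1))%R.
  move=> x0; have h : (x \in `]0%R, +oo[)%R by rewrite in_itv/= x0.
  have d1 : derivable (fun t : R => t `^ a)%R x 1 by exact: derivable_powR.
  apply: DeriveDef; first exact: derivableM.
  rewrite -derive1E derive1Ml// powR_derive1// mulrA mulVf ?mul1r// gt_eqF//.
rewrite (@continuous_FTC2 _ _ (fun t : R => (a^-1 * t `^ a)%R))//.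
- rewrite -EFinB lee_fin powR1 mulr1 gerBl mulr_ge0 ?powR_ge0// invr_ge0 ltW//.
- apply: continuous_in_subspaceT => x; rewrite inE/= in_itv/= => /andP[h _].
  by apply: continuous_powR; exact: lt_le_trans h.
- have cF x : (0 < x)%R -> {for x, continuous (fun t : R => (a^-1 * t `^ a)%R)}.
    by move=> x0; apply: continuousM; [exact: cst_continuous|exact: continuous_powR].
  split.
  + move=> x; rewrite in_itv/= => /andP[h _].
    by have [] := dF x (lt_trans n0 h).
  + by apply: cvg_at_right_filter; exact: cF.
  + by apply: cvg_at_left_filter; exact: cF.
- move=> x; rewrite in_itv/= => /andP[h _].
  by have [_ <-] := dF x (lt_trans n0 h); rewrite derive1E.
Unshelve. all: by end_near. Qed.

(** Extended by 0 to the whole line, so that two such functions can be convolved. *)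
Definition gamma_density a : R -> \bar R :=
  (fun t => (t `^ (a - 1) * expR (- t))%:E) \_ `]0%R, +oo[.

Lemma gamma_density_ge0 a t : 0 <= gamma_density a t.
Proof.
by apply: erestrict_ge0 => {}t _; rewrite lee_fin mulr_ge0 ?powR_ge0 ?expR_ge0.
Qed.

Lemma measurable_gamma_density a : measurable_fun setT (gamma_density a).
Proof.
apply/(measurable_restrictT _ _).1; first exact: measurable_itv.
apply/measurable_EFinP; apply: measurable_funTS; apply: measurable_funM.
  exact: measurable_powR.
by apply: measurableT_comp.
Qed.

(** With q = t / (2a), ln q < q gives a ln q <= t/2. Only exp(t/2) is spent, so that exp(-t) leaves
    an integrable exp(-t/2). *)
Lemma powR_le_expR a t : (0 < a)%R -> (0 < t)%R ->
  (t `^ a <= (2 * a) `^ a * expR (2^-1 * t))%R.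
Proof.
move=> a0 t0; have a20 : (0 < 2 * a)%R by rewrite mulr_gt0.
rewrite {1}(_ : t = 2 * a * (t / (2 * a)))%R; last by field; rewrite gt_eqF.
have q0 : (0 < t / (2 * a))%R by rewrite divr_gt0.
rewrite (powRM _ (ltW a20) (ltW q0)) ler_pM2l ?powR_gt0//.
rewrite {1}/powR gt_eqF// ler_expR.
have := ln_sublinear q0; rewrite -(ltr_pM2l a0) => /ltW/le_trans; apply.
by rewrite le_eqVlt; apply/orP; left; apply/eqP; field; rewrite gt_eqF.
Qed.

(** The density is dominated by t^(a-1) on ]0, 1] and by a multiple of the exponential density of
    rate 1/2 beyond 1. *)
Lemma integral_gamma_density_lty a : (0 < a)%R -> \int[mu]_t gamma_density a t < +oo.
Proof.
move=> a0.
pose f1 : R -> \bar R := (fun t => (t `^ (a - 1))%:E) \_ `]0%R, 1%R].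
(* The factor 2 cancels the normalising rate 1/2 of the exponential density; the other factor comes
   from [powR_le_expR]. *)
pose f2 (t : R) : \bar R := (2 * (2 * a) `^ a)%:E * (exponential_pdf 2^-1 t)%:E.
have f10 t : 0 <= f1 t by apply: erestrict_ge0 => {}t _; rewrite lee_fin powR_ge0.
have e0 t : (0 <= exponential_pdf 2^-1 t :> R)%R by rewrite exponential_pdf_ge0.
have f20 t : 0 <= f2 t.
  by rewrite mule_ge0// lee_fin// mulr_ge0// powR_ge0.
have mf1 : measurable_fun setT f1.
  apply/(measurable_restrictT _ _).1; first exact: measurable_itv.
  by apply/measurable_EFinP; apply: measurable_funTS; exact: measurable_powR.
have me : measurable_fun setT (fun t : R => (exponential_pdf 2^-1 t)%:E).
  by apply/measurable_EFinP; exact: measurable_exponential_pdf.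
have mf2 : measurable_fun setT f2 by exact: measurable_funeM.
apply: (@le_lt_trans _ _ (\int[mu]_t (f1 t + f2 t))).
  apply: ge0_le_integral => //.
  - by move=> t _; exact: gamma_density_ge0.
  - exact: measurable_gamma_density.
  - exact: emeasurable_funD.
  move=> t _; rewrite /gamma_density patchE; case: ifPn => [|_]; last exact: adde_ge0.
  rewrite inE/= in_itv/= andbT => t0.
  have [t1|t1] := leP t 1%R.
    apply: (@le_trans _ _ (f1 t)); last by rewrite leeDl.
    rewrite /f1 patchE mem_set/= ?in_itv/= ?t0// lee_fin.
    by rewrite ler_piMr ?powR_ge0// -expR0 ler_expR oppr_le0 ltW.
  apply: (@le_trans _ _ (f2 t)); last by rewrite leeDr.
  rewrite /f2 -EFinM lee_fin (exponential_pdfE _ (ltW t0)).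
  have -> : (expR (- t) = expR (2^-1 * - t) * expR (2^-1 * - t))%R.
    by rewrite -expRD; congr expR; field.
  have h : (t `^ (a - 1) <= (2 * a) `^ a * expR (2^-1 * t))%R.
    apply: le_trans (powR_le_expR a0 t0).
    by rewrite (ler_powR (ltW t1))// gerBl.
  rewrite (_ : - 2^-1 * t = 2^-1 * - t)%R; last by field.
  set E := expR (2^-1 * - t)%R.
  rewrite (_ : 2 * _ * (2^-1 * E) = (2 * a) `^ a * E)%R; last by field.
  rewrite mulrA ler_wpM2r ?expR_ge0//.
  apply: le_trans (_ : ((2 * a) `^ a * expR (2^-1 * t)) * E <= _)%R.
    by rewrite ler_wpM2r ?expR_ge0.
  by rewrite -mulrA -expRD mulrN subrr expR0 mulr1.
rewrite ge0_integralD// ge0_integralZl//; last by rewrite lee_fin mulr_ge0 ?powR_ge0.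
rewrite integral_exponential_pdf// mule1 lte_add_pinfty ?ltry//.
  by rewrite /f1 -integral_mkcond; exact: le_lt_trans (integral_powR_le a0) (ltry _).
by move=> x _; rewrite lee_fin.
Qed.

Lemma GammaE a : (0 < a)%R -> (Gamma a)%:E = \int[mu]_t gamma_density a t.
Proof.
move=> a0; rewrite /Gamma /Rintegral integral_mkcond fineK//.
rewrite ge0_fin_numE; first exact: integral_gamma_density_lty.
by apply: integral_ge0 => t _; exact: gamma_density_ge0.
Qed.

(** On [1, 2] the integrand is bounded below: t^(a-1) >= 1/t >= 1/2 because a > 0, and exp(-t) >=
    exp(-2). *)
Lemma Gamma_gt0 a : (0 < a)%R -> (0 < Gamma a)%R.
Proof.
move=> a0; rewrite -lte_fin GammaE// -integral_mkcond.
have m12 : measurable (`[1%R, 2%R]%classic : set R) by exact: measurable_itv.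
have mg : measurable_fun setT (fun t : R => (t `^ (a - 1) * expR (- t))%:E).
  apply/measurable_EFinP; apply: measurable_funM; first exact: measurable_powR.
  exact: measurableT_comp.
have g0 t : 0 <= (t `^ (a - 1) * expR (- t))%:E.
  by rewrite lee_fin mulr_ge0 ?powR_ge0 ?expR_ge0.
apply: (@lt_le_trans _ _
  (\int[mu]_(t in `[1%R, 2%R]) (cst (2^-1 * expR (- 2))%:E t))).
  rewrite integral_cst//= lebesgue_measure_itv/= lte_fin ltr1n.
  by rewrite -EFinB -EFinM lte_fin mulr_gt0 ?mulr_gt0 ?expR_gt0 ?subr_gt0 ?ltr1n.
apply: (@le_trans _ _ (\int[mu]_(t in `[1%R, 2%R]) (t `^ (a - 1) * expR (- t))%:E)).
  apply: ge0_le_integral => //.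
  - by move=> t _; rewrite lee_fin mulr_ge0 ?expR_ge0.
  - exact: measurable_funTS.
  move=> t /=; rewrite in_itv/= => /andP[t1 t2].
  have t0 : (0 < t)%R by exact: lt_le_trans t1.
  rewrite lee_fin ler_pM ?expR_ge0//; last by rewrite ler_expR lerN2.
  apply: (@le_trans _ _ (t `^ (-1))%R); last by rewrite ler_powR// lerBrDr addNr ltW.
  by rewrite (powR_inv1 (ltW t0)) lef_pV2 ?posrE.
apply: ge0_subset_integral => //; first exact: measurable_funTS.
by move=> t /=; rewrite !in_itv/= andbT => /andP[t1 _]; exact: lt_le_trans t1.
Qed.

Lemma Gamma1 : Gamma 1 = 1%R :> R.
Proof.
apply: EFin_inj; rewrite GammaE// -(@integral_exponential_pdf R 1)//.
rewrite -integral_mkcond integral_itv_obnd_cbnd; last first.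
  apply/measurable_EFinP; apply: measurable_funTS; apply: measurable_funM.
    exact: measurable_powR.
  exact: measurableT_comp.
rewrite integral_mkcond; apply: eq_integral => t _.
rewrite /exponential_pdf !patchE; case: ifP => // _.
by rewrite subrr powRr0 !mul1r mulN1r.
Qed.

Definition beta_integrand a b u t : R := ((u - t) `^ (a - 1) * t `^ (b - 1))%R.

(** Euler's Beta function, kept extended-real: its finiteness for positive arguments is deduced from
    [Gamma_beta]. *)
Definition beta_integral a b : \bar R :=
  \int[mu]_(t in `]0%R, 1%R[) (beta_integrand a b 1 t)%:E.

Lemma measurable_beta_integrand a b u :
  measurable_fun setT (beta_integrand a b u).
Proof.
apply: measurable_funM; last exact: measurable_powR.
apply: (@measurableT_comp _ _ _ _ _ _ (fun x : R => x `^ (a - 1))%R).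
  exact: measurable_powR.
exact: measurable_funB.
Qed.

Lemma beta_integrand_ge0 a b u t : 0 <= (beta_integrand a b u t)%:E.
Proof. by rewrite lee_fin mulr_ge0 ?powR_ge0. Qed.

Lemma beta_integral_ge0 a b : 0 <= beta_integral a b.
Proof. by apply: integral_ge0 => t _; exact: beta_integrand_ge0. Qed.

(** Substitute t = u s: the exponent of [u] collects 1 from the measure and a - 1, b - 1 from the
    two powers. *)
Lemma beta_integral_scale a b u : (0 < u)%R ->
  \int[mu]_(t in `]0%R, u[) (beta_integrand a b u t)%:E =
  (u `^ (a + b - 1))%:E * beta_integral a b.
Proof.
move=> u0; rewrite integral_mkcond (@ge0_integral_affine _ u 0)//; last first.
  - by apply: erestrict_ge0 => t _; exact: beta_integrand_ge0.
  - apply/(measurable_restrictT _ _).1; first exact: measurable_itv.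
    by apply/measurable_EFinP; apply: measurable_funTS; exact: measurable_beta_integrand.
rewrite /beta_integral [in RHS]integral_mkcond.
have mb : measurable_fun setT ((EFin \o beta_integrand a b 1) \_ `]0%R, 1%R[).
  apply/(measurable_restrictT _ _).1; first exact: measurable_itv.
  by apply/measurable_EFinP; apply: measurable_funTS; exact: measurable_beta_integrand.
have b0 t : 0 <= ((EFin \o beta_integrand a b 1) \_ `]0%R, 1%R[) t.
  by apply: erestrict_ge0 => {}t _; exact: beta_integrand_ge0.
rewrite -[LHS]ge0_integralZl//; last 3 first.
- apply: (@measurableT_comp _ _ _ _ _ _
    ((EFin \o beta_integrand a b u) \_ `]0%R, u[) _ (fun x => u * x + 0)%R).
    apply/(measurable_restrictT _ _).1; first exact: measurable_itv.
    by apply/measurable_EFinP; apply: measurable_funTS; exact: measurable_beta_integrand.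
  by apply: measurable_funD => //; exact: measurable_funM.
- by move=> t _; apply: erestrict_ge0 => {}t _; exact: beta_integrand_ge0.
- by rewrite lee_fin ltW.
rewrite -[RHS]ge0_integralZl//; last by rewrite lee_fin powR_ge0.
apply: eq_integral => t _; rewrite !patchE addr0.
have -> : ((u * t)%R \in `]0%R, u[%classic) = (t \in `]0%R, 1%R[%classic).
  by rewrite !mem_setE !in_itv/= pmulr_rgt0// gtr_pMr.
case: ifPn => [|_]; last by rewrite !mule0.
rewrite inE/= in_itv/= => /andP[t0 t1].
rewrite -!EFinM /beta_integrand; congr (_ %:E).
rewrite (_ : u - u * t = u * (1 - t))%R; last by ring.
rewrite (powRM _ (ltW u0) (ltW t0)) powRM ?ltW ?subr_gt0//.
rewrite (_ : a + b - 1 = 1 + (a - 1) + (b - 1))%R; last by ring.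
have uD c d : (u `^ (c + d) = u `^ c * u `^ d)%R.
  by rewrite powRD// (gt_eqF u0) implybT.
by rewrite !uD (powRr1 (ltW u0)); ring.
Qed.

(** The exponentials multiply to exp(-u), free of [t], and the two supports meet in ]0, u[. *)
Lemma gamma_density_mul a b u t :
  gamma_density a (u - t) * gamma_density b t =
  (expR (- u))%:E * ((EFin \o beta_integrand a b u) \_ `]0%R, u[) t.
Proof.
rewrite /gamma_density !patchE.
have -> : (t \in `]0%R, u[%classic) =
    ((u - t)%R \in `]0%R, +oo[%classic) && (t \in `]0%R, +oo[%classic).
  by rewrite !mem_setE !in_itv/= !andbT subr_gt0 andbC.
case: ifPn => _; last by rewrite mul0e mule0.
case: ifPn => _; last by rewrite !mule0.
rewrite -!EFinM /beta_integrand; congr (_ %:E).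
rewrite (_ : - u = - (u - t) + - t)%R; last by ring.
by rewrite expRD; ring.
Qed.

(* The convolution of the densities of [Gamma a] and [Gamma b] is
   [beta_integral a b] times the density of [Gamma (a + b)]. *)
Lemma Gamma_beta a b : (0 < a)%R -> (0 < b)%R ->
  (Gamma a * Gamma b)%:E = beta_integral a b * (Gamma (a + b))%:E.
Proof.
move=> a0 b0; rewrite EFinM !GammaE ?addr_gt0//.
have mg c : measurable_fun setT (gamma_density c) by exact: measurable_gamma_density.
have g0 c t : 0 <= gamma_density c t by exact: gamma_density_ge0.
have mB u : measurable_fun setT ((EFin \o beta_integrand a b u) \_ `]0%R, u[).
  apply/(measurable_restrictT _ _).1; first exact: measurable_itv.
  by apply/measurable_EFinP; apply: measurable_funTS; exact: measurable_beta_integrand.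
rewrite -ge0_integral_convolution// -ge0_integralZl//; last 2 first.
- exact: measurable_gamma_density.
- exact: beta_integral_ge0.
apply: eq_integral => u _.
transitivity (\int[mu]_t ((expR (- u))%:E * ((EFin \o beta_integrand a b u) \_ `]0%R, u[) t)).
  by apply: eq_integral => t _; rewrite gamma_density_mul.
rewrite ge0_integralZl//; last 2 first.
- exact: mB.
- by move=> t _; apply: erestrict_ge0 => {}t _; exact: beta_integrand_ge0.
rewrite -integral_mkcond; have [u0|u0] := leP u 0%R.
  rewrite set_itv_ge; last by rewrite bnd_simp -leNgt.
  rewrite integral_set0 mule0 /gamma_density patchE memNset ?mule0//.
  by rewrite /= in_itv/= andbT ltNge u0.
rewrite beta_integral_scale// /gamma_density patchE mem_set; last first.
  by rewrite /= in_itv/= andbT.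
by rewrite muleA -EFinM muleC (mulrC (expR _)).
Qed.

End GammaFunction.

(** * Riemann-Liouville integrals *)

Section RiemannLiouville.
Context {R : realType}.
Notation mu := (@lebesgue_measure R).
Implicit Types (a b c x : R) (f g : R -> R).

Lemma eqL1_refl f : eqL1 f f.
Proof. exact: ae_eq_refl. Qed.

Lemma eqL1_sym f g : eqL1 f g -> eqL1 g f.
Proof. exact: ae_eq_sym. Qed.

Lemma eqL1_trans f g h : eqL1 f g -> eqL1 g h -> eqL1 f h.
Proof. exact: ae_eq_trans. Qed.

Lemma eq_in_eqL1 f g : {in `[0, 1], f =1 g} -> eqL1 f g.
Proof. by move=> fg; apply: aeW => x /= x01; exact: fg. Qed.

Lemma L1_measurable f : L1 f -> measurable_fun (`[0, 1]%classic : set R) f.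
Proof. by move=> /measurable_int/measurable_EFinP. Qed.

Lemma L1_restrict f : L1 f -> mu.-integrable setT (EFin \o (f \_ `[0, 1])).
Proof. by rewrite -restrict_EFin => /(integrable_mkcond _ _).1; apply. Qed.

Lemma integrableT_L1 f : mu.-integrable setT (EFin \o f) -> L1 f.
Proof. by apply: integrableS. Qed.

Lemma eq_in_L1 f g : {in `[0, 1], f =1 g} -> L1 f -> L1 g.
Proof.
by move=> fg; apply: eq_integrable => // x; rewrite inE/= => x01; rewrite fg.
Qed.

(* The truncation to ]0, 1] makes the kernel integrable on the whole line without
   changing the convolution with a function supported by [0, 1], on [0, 1]. *)
Definition rlker a : R -> R :=
  (fun t => (Gamma a)^-1 * t `^ (a - 1)) \_ `]0, 1].

Lemma integrable_rlker a : 0 < a -> mu.-integrable setT (EFin \o rlker a).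
Proof.
move=> a0; rewrite /rlker -restrict_EFin; apply: (integrable_mkcond _ _).1 => //.
have h : mu.-integrable `]0, 1] (fun t : R => (t `^ (a - 1))%:E).
  apply/integrableP; split.
    by apply/measurable_EFinP; apply: measurable_funTS; exact: measurable_powR.
  apply: le_lt_trans (ltry a^-1); apply: le_trans (integral_powR_le a0).
  by under eq_integral do rewrite gee0_abs ?lee_fin ?powR_ge0//.
by apply: (integrableZl _ _ h).
Qed.

(** For t in [0, x[ the difference x - t lies in ]0, 1], where the kernel is not truncated. The
    endpoint t = x, where the truncated kernel is 0, is a null set. *)
Lemma RLint_convolution a f x : 0 < a -> L1 f -> x \in `[0, 1] ->
  RLint a f x = convolution (rlker a) (f \_ `[0, 1]) x.
Proof.
move=> a0 f1 x01; rewrite /RLint gt_eqF//.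
pose g t := (x - t) `^ (a - 1) * f t.
have x01' := x01; move: x01'; rewrite in_itv/= => /andP[x0 x1].
have mg : measurable_fun (`[0, x[%classic : set R) g.
  apply: measurable_funM.
    apply: measurable_funTS.
    apply: (@measurableT_comp _ _ _ _ _ _ (fun t : R => t `^ (a - 1))).
      exact: measurable_powR.
    exact: measurable_funB.
  apply: measurable_funS (L1_measurable f1) => // t /=.
  by rewrite !in_itv/= => /andP[-> /ltW/le_trans->].
transitivity ((Gamma a)^-1 * \int[mu]_t (g \_ `[0, x[) t).
  congr (_ * _); rewrite -Rintegral_mkcond /Rintegral integral_itv_bndo_bndc//.
  exact/measurable_EFinP.
rewrite -measurable_RintegralZl; last first.
  by apply/(measurable_restrictT _ _).1.
apply: eq_Rintegral => t _; rewrite /rlker !patchE !mem_setE !in_itv/=.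
rewrite subr_gt0 lerBlDr; have [t0|t0] /= := leP 0 t; last by rewrite !mulr0.
have [tx|tx] /= := ltP t x; last by rewrite mulr0 mul0r.
by rewrite (le_trans x1) ?lerDl// (le_trans (ltW tx))// mulrA.
Qed.

Lemma rlker_eq0 a x : x <= 0 -> rlker a x = 0.
Proof.
by move=> x0; rewrite /rlker patchE memNset//= in_itv/= ltNge x0.
Qed.

(** For 0 < x <= 1 only t in ]0, x[ contributes, and there t and x - t are at most 1, so the
    truncation at 1 is invisible. What remains is a scaled Beta integral. *)
Lemma convolution_rlker a b x : 0 < a -> 0 < b -> x <= 1 ->
  convolution (rlker a) (rlker b) x = rlker (a + b) x.
Proof.
move=> a0 b0 x1; have [x0|x0] := leP x 0.
  rewrite rlker_eq0//; apply: Rintegral_eq0 => t.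
  have [t0|t0] := leP t 0; first by rewrite (rlker_eq0 b t0) mulr0.
  by rewrite rlker_eq0 ?mul0r// subr_le0 (le_trans x0)// ltW.
pose h := (beta_integrand a b x) \_ `]0, x[.
have mh : measurable_fun setT h.
  apply/(measurable_restrictT _ _).1 => //.
  by apply: measurable_funTS; exact: measurable_beta_integrand.
transitivity (\int[mu]_t ((Gamma a * Gamma b)^-1 * h t)).
  apply: eq_Rintegral => t _; rewrite /rlker /h !patchE !mem_setE !in_itv/=.
  rewrite subr_gt0; have [t0|t0] /= := ltP 0 t; last by rewrite !mulr0.
  have [tx|tx] /= := ltP t x; last by rewrite mulr0 mul0r.
  rewrite (_ : x - t <= 1); last by rewrite lerBlDr (le_trans x1)// lerDl ltW.
  rewrite (_ : t <= 1); last by rewrite (le_trans (ltW tx)).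
  by rewrite /beta_integrand invfM; ring.
rewrite measurable_RintegralZl// /h -Rintegral_mkcond /Rintegral.
rewrite beta_integral_scale// /rlker patchE mem_set/=; last by rewrite in_itv/= x0.
have Ga := Gamma_gt0 a0; have Gb := Gamma_gt0 b0.
have Gab : 0 < Gamma (a + b) by rewrite Gamma_gt0// addr_gt0.
have := Gamma_beta a0 b0.
(* An infinite Beta integral would make the right-hand side of [Gamma_beta] infinite, while the
   left-hand side is real. *)
case: (beta_integral a b) (beta_integral_ge0 a b) => [B| |]//= _.
  move=> [GB]; have -> : B = Gamma a * Gamma b / Gamma (a + b).
    by rewrite GB mulfK// gt_eqF.
  by field; rewrite !gt_eqF.
by rewrite gt0_mulye// lte_fin.
Qed.

Lemma RLint_L1 a f : 0 <= a -> L1 f -> L1 (RLint a f).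
Proof.
rewrite le_eqVlt => /predU1P[<-|a0] f1; first by rewrite /RLint eqxx.
apply: (@eq_in_L1 (convolution (rlker a) (f \_ `[0, 1]))).
  by move=> x x01; rewrite RLint_convolution.
by apply/integrableT_L1/integrable_convolution; [exact: integrable_rlker|exact: L1_restrict].
Qed.

Lemma eq_RLint a f g : L1 f -> L1 g -> eqL1 f g -> eqL1 (RLint a f) (RLint a g).
Proof.
move=> f1 g1 fg; rewrite /RLint; case: ifP => // _.
apply: eq_in_eqL1 => x; rewrite in_itv/= => /andP[x0 x1]; congr (_ * _).
have sub : `[0, x] `<=` (`[0, 1] : set R).
  by move=> t /=; rewrite !in_itv/= => /andP[-> /le_trans->].
have mp : measurable_fun (`[0, x]%classic : set R) (fun t => (x - t) `^ (a - 1)).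
  apply: measurable_funTS.
  apply: (@measurableT_comp _ _ _ _ _ _ (fun t : R => t `^ (a - 1))).
    exact: measurable_powR.
  exact: measurable_funB.
apply: ae_eq_Rintegral => //.
- by apply: measurable_funM => //; apply: measurable_funS (L1_measurable f1).
- by apply: measurable_funM => //; apply: measurable_funS (L1_measurable g1).
- by move: fg; apply: (@filterS _ _ (ae_filter_ringOfSetsType mu)) => t fgt /sub/fgt ->.
Qed.

(** Order 0 is split off, being the identity by definition; positive orders reduce to
    [convolution_assoc] and [convolution_rlker]. *)
Lemma RLint_comp a b f : 0 <= a -> 0 <= b -> L1 f ->
  eqL1 (RLint a (RLint b f)) (RLint (a + b) f).
Proof.
rewrite le_eqVlt => /predU1P[<- _ _|a0].
  by rewrite add0r {1}/RLint eqxx; exact: eqL1_refl.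
rewrite le_eqVlt => /predU1P[<- _|b0 f1].
  by rewrite addr0 [RLint 0 f]/RLint eqxx; exact: eqL1_refl.
have ki := integrable_rlker a0; have li := integrable_rlker b0.
have fi := L1_restrict f1.
have := convolution_assoc ki li fi.
apply: (@filterS _ _ (ae_filter_ringOfSetsType mu)) => x assoc x01.
have x01' : x \in `[0, 1] by [].
have := x01'; rewrite in_itv/= => /andP[x0 x1].
rewrite RLint_convolution//; last by apply: RLint_L1 => //; exact: ltW.
rewrite (RLint_convolution _ f1 x01') ?addr_gt0//.
(* The inner function may lose its restriction to [0, 1]: for t < 0 the inner convolution vanishes,
   for t > 1 the outer kernel does. *)
transitivity (convolution (rlker a) (convolution (rlker b) (f \_ `[0, 1])) x).
  apply: eq_Rintegral => t _; rewrite [in LHS]patchE mem_setE.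
  case: ifPn => [t01|]; first by rewrite RLint_convolution.
  rewrite in_itv/= negb_and -!ltNge => /orP[t0|t1].
    rewrite mulr0 [X in _ * X](_ : _ = 0) ?mulr0//.
    apply: Rintegral_eq0 => s; rewrite patchE mem_setE in_itv/=.
    have [s0|s0] /= := leP 0 s; last by rewrite mulr0.
    by rewrite rlker_eq0 ?mul0r// subr_le0 (le_trans (ltW t0)).
  by rewrite rlker_eq0 ?mul0r// subr_le0 (le_trans x1)// ltW.
rewrite assoc; apply: eq_Rintegral => s _; rewrite patchE mem_setE in_itv/=.
have [s0|s0] /= := leP 0 s; last by rewrite !mulr0.
by rewrite convolution_rlker// lerBlDr (le_trans x1)// lerDl.
Qed.

End RiemannLiouville.

(** * Derivatives of absolutely continuous functions *)

Section WeakDerivative.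
Context {R : realType}.
Notation mu := (@lebesgue_measure R).
Implicit Types (a c x : R) (f g h phi psi F : R -> R).

Lemma RLint1 f x : RLint 1 f x = \int[mu]_(t in `[0, x]) f t.
Proof.
rewrite /RLint oner_eq0 Gamma1 invr1 mul1r subrr.
by apply: eq_Rintegral => t _; rewrite powRr0 mul1r.
Qed.

Lemma AC_RLint1 phi : L1 phi -> AC_with_derivative (RLint 1 phi) phi.
Proof.
move=> phi1; split => // x _.
by rewrite !RLint1 set_itv1 Rintegral_set1 add0r.
Qed.

Lemma ae_neq c : {ae mu, forall x, x != c}.
Proof.
exists [set c]; split => //; first exact: lebesgue_measure_set1.
by move=> x /=; move/negP/negPn/eqP.
Qed.

(** The primitive is continuous: if it differed from [c] at a point, it would differ on a whole
    ball, which has positive measure. *)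
Lemma ae_cst_primitive psi c : L1 psi ->
  eqL1 (RLint 1 psi) (cst c) -> {in `]0, 1[, forall x, RLint 1 psi x = c}.
Proof.
move=> psi1 Gc x x01; apply/eqP/negPn/negP => Gxc.
have Gint : RLint 1 psi = fun x => \int[mu]_(t in `[0, x]) psi t.
  by apply/funext => y; rewrite RLint1.
have cG : {in `]0, 1[, continuous (RLint 1 psi)}.
  have := parameterized_integral_continuous ler01 psi1.
  by move/(continuous_within_itvP _ ltr01) => [+ _ _]; rewrite Gint.
have : \forall y \near x, (y \in `]0, 1[) /\ RLint 1 psi y - c != 0.
  apply: filterI; first exact: near_in_itvoo.
  apply: (@cvgr_neq0 _ _ _ (nbhs x) _ (fun y => RLint 1 psi y - c)
    (RLint 1 psi x - c)); last by rewrite subr_eq0.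
  by apply: cvgB; [exact: cG|exact: cvg_cst].
move=> /nbhs_ballP[e /= e0 xe].
have : mu.-negligible (ball x e).
  apply: negligibleS Gc => y /xe[y01 yc] /= h; move: yc.
  rewrite h ?subrr ?eqxx//.
  by move: y01; rewrite /= !in_itv/= => /andP[/ltW-> /ltW->].
have mB : measurable (ball x e : set (measurableTypeR R)) by exact: measurable_ball.
move=> /(negligibleP mu mB) /= B0.
have : (e *+ 2)%:E = 0%E :> \bar R by rewrite -(lebesgue_measure_ball x (ltW e0)).
by move/eqP; rewrite eqe mulrn_eq0/= gt_eqF.
Qed.

(** At a Lebesgue point the primitive has derivative [psi x], and it is constant near every interior
    point. *)
Lemma ae_cst_primitive_eq0 psi c : L1 psi ->
  eqL1 (RLint 1 psi) (cst c) -> eqL1 psi (cst 0).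
Proof.
move=> psi1 /(ae_cst_primitive psi1) Gc.
(* Lebesgue differentiation is applied on the whole line, hence the extension by 0. *)
pose psi' := psi \_ (`[0, 1]%classic : set R).
have psi'1 : mu.-integrable `[0, 1] (EFin \o psi').
  exact: integrableS (L1_restrict psi1).
have psi'E t : t \in `[0, 1] -> psi' t = psi t.
  by move=> t01; rewrite /psi' patchE mem_set.
have := lebesgue_differentiation
  (integrable_locally (measurable_itv `[0, 1]) psi1).
have aeF := ae_filter_ringOfSetsType mu.
move: (ae_neq 0) (ae_neq 1); apply: (@filterS3 _ _ aeF) => x x0 x1 lx.
rewrite /= in_itv/= => /andP[x0' x1'].
have x01 : x \in `]0, 1[ by rewrite in_itv/= !lt_neqAle eq_sym x0 x0' x1 x1'.
have := x01; rewrite in_itv/= => /andP[xgt0 xlt1].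
have [_] := FTC1_lebesgue_pt xlt1 psi'1 xgt0 lx.
rewrite psi'E; last by rewrite in_itv/= x0' x1'.
move=> <-; rewrite derive1E.
transitivity ('D_1 (cst c : R^o -> R^o) x); last exact: derive_cst.
apply: near_eq_derive; near=> y.
have y01 : y \in `]0, 1[ by near: y; exact: near_in_itvoo.
rewrite -(Gc y y01) RLint1; apply: eq_Rintegral => t.
rewrite inE/= in_itv/= => /andP[t0 ty]; rewrite psi'E// in_itv/= t0/=.
by move: y01; rewrite in_itv/= => /andP[_ /ltW]; exact: le_trans.
Unshelve. all: by end_near. Qed.

(** The primitive of [g - f] is almost everywhere [c]. The constant leaves room for the value at 0
    of an absolutely continuous representative. *)
Lemma RLint1_inj f g c : L1 f -> L1 g ->
  eqL1 (fun x => c + RLint 1 f x) (RLint 1 g) -> eqL1 f g.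
Proof.
move=> f1 g1 fg; have gf1 : L1 (g \- f).
  by apply: (integrableB _ g1 f1).
have : eqL1 (g \- f) (cst 0).
  apply: (@ae_cst_primitive_eq0 _ c) => //.
  move: fg; apply: (@filterS _ _ (ae_filter_ringOfSetsType mu)) => x fg x01.
  have sub h : L1 h -> mu.-integrable `[0, x] (EFin \o h).
    apply: integrableS => // t /=.
    by move: x01; rewrite /= !in_itv/= => /andP[_ x1] /andP[-> /le_trans->].
  rewrite RLint1 RintegralB ?sub// -!RLint1 -(fg x01) addrK//.
apply: (@filterS _ _ (ae_filter_ringOfSetsType mu)) => x h x01.
by apply/esym/eqP; rewrite -subr_eq0; apply/eqP; exact: h.
Qed.

Lemma inAC_RLint1 h phi : L1 phi -> eqL1 h (RLint 1 phi) -> inAC h.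
Proof.
by move=> phi1 hphi; exists (RLint 1 phi); split => //; exists phi; exact: AC_RLint1.
Qed.

(** Whatever derivative [ddx] selects, its primitive equals that of [phi] up to a constant, so
    [RLint1_inj] identifies the two. *)
Lemma ddx_RLint1 h phi : L1 phi -> eqL1 h (RLint 1 phi) ->
  L1 (ddx h) /\ eqL1 (ddx h) phi.
Proof.
move=> phi1 hphi.
have [|F [hF [d1 FE]]] := xgetPex (cst 0 : R -> R)
    (P := [set phi | exists F, eqL1 h F /\ AC_with_derivative F phi]).
  by exists phi, (RLint 1 phi); split => //; exact: AC_RLint1.
split => //; apply: (@RLint1_inj _ _ (F 0)) => //.
apply: eqL1_trans hphi; apply: eqL1_sym; apply: eqL1_trans hF _.
by apply: eq_in_eqL1 => x x01; rewrite FE// RLint1.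
Qed.

End WeakDerivative.

(** * Unfolding the product of operators and the partial sums *)

Section ProdFrom.
Context {R : realType} (n : nat) (gamma : 'rV[R]_n).

Let T := R -> R.

#[local] HB.instance Definition _ := Monoid.isLaw.Build (T -> T) idfun
  (@comp T T T) (fun f g h => erefl) (fun f => erefl) (fun f => erefl).

Lemma prod_from_empty h : prod_from gamma n.+1 h = h.
Proof.
by rewrite /prod_from big_pred0// => j; apply/negbTE; rewrite -ltnNge ltnS.
Qed.

Lemma prod_from_recl (j : 'I_n) h :
  prod_from gamma j.+1 h = RLint (gamma 0 j) (ddx (prod_from gamma j.+2 h)).
Proof.
(* Factors are reindexed by natural numbers, so that the product runs over an interval whose first,
   outermost factor splits off. *)
pose G k := if insub k is Some i then RLint (gamma 0 i) \o @ddx R else idfun.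
have GE i : prod_from gamma i.+1 = \big[@comp T T T/idfun]_(i <= k < n) G k.
  rewrite big_geq_mkord /prod_from; apply: eq_big => // k _.
  by rewrite /G valK.
by rewrite !GE big_ltn//= /G valK.
Qed.

Lemma psum0 : psum gamma 0 = 0.
Proof. exact: big_pred0. Qed.

Lemma psumS (j : 'I_n) : psum gamma j.+1 = psum gamma j + gamma 0 j.
Proof.
rewrite /psum (bigD1 j)//= addrC; congr (_ + _).
by apply: eq_bigl => i; rewrite ltnS ltn_neqAle andbC.
Qed.

End ProdFrom.

(** * Left inverse *)

Section LeftInverse.
Context {R : realType} (n : nat) (alpha : R) (gamma : 'rV[R]_n).
Hypothesis alpha01 : 0 < alpha <= 1.
Hypothesis gammaP : forall j : 'I_n,
  0 <= gamma 0 j /\ alpha + psum gamma j.+1 <= j.+1%:R.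
Variables f phi : R -> R.
Hypotheses (f1 : L1 f) (phi1 : L1 phi).
Hypothesis fphi : eqL1 (RLint alpha f) (RLint 1 phi).

Let alpha0 : 0 <= alpha. Proof. by case/andP: alpha01 => /ltW. Qed.

(** Nonnegativity is available for k >= 1 only: c_0 = -alpha, which enters through 1 + c_0 = 1 -
    alpha. *)
Let c k : R := k%:R - alpha - psum gamma k.

Let c_ge0 (j : 'I_n) : 0 <= c j.+1.
Proof. by rewrite /c -addrA -opprD subr_ge0; case: (gammaP j). Qed.

Let cS (j : 'I_n) : gamma 0 j + c j.+1 = 1 + c j.
Proof. by rewrite /c psumS -natr1; ring. Qed.

Let h0 := RLint (n%:R - alpha - psum gamma n) (RLint alpha f).

(** I^1 I^(1 - alpha) phi = I^(1 - alpha) I^1 phi = I^(1 - alpha) I^alpha f = I^1 f, and I^1 is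
    injective. *)
Lemma RLint_onem_derivative : eqL1 (RLint (1 - alpha) phi) f.
Proof.
have a1 : 0 <= 1 - alpha by rewrite subr_ge0; case/andP: alpha01.
apply: (@RLint1_inj _ _ _ 0) => //; first exact: RLint_L1.
apply: (@eqL1_trans _ _ (RLint 1 (RLint (1 - alpha) phi))).
  by apply: eq_in_eqL1 => x _; rewrite add0r.
apply: eqL1_trans (RLint_comp ler01 a1 phi1) _; rewrite addrC.
apply: eqL1_trans (eqL1_sym (RLint_comp a1 ler01 phi1)) _.
apply: eqL1_trans (eqL1_sym (eq_RLint _ _ _ fphi)) _; [exact: RLint_L1..|].
by apply: eqL1_trans (RLint_comp a1 alpha0 f1) _; rewrite subrK; exact: eqL1_refl.
Qed.

(** The order 1 + c_j is left unsplit so that j = 0, where c_j is negative, is covered too. *)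
Lemma prod_from_step (j : 'I_n) :
  eqL1 (prod_from gamma j.+2 h0) (RLint 1 (RLint (c j.+1) phi)) ->
  eqL1 (prod_from gamma j.+1 h0) (RLint (1 + c j) phi).
Proof.
move=> Hj; rewrite prod_from_recl -cS.
have [g0 _] := gammaP j.
have c1 : L1 (RLint (c j.+1) phi) by exact: RLint_L1.
have [d1 dphi] := ddx_RLint1 c1 Hj.
by apply: eqL1_trans (eq_RLint _ d1 c1 dphi) _; exact: RLint_comp.
Qed.

Lemma prod_from_RLint (j : 'I_n) :
  eqL1 (prod_from gamma j.+2 h0) (RLint 1 (RLint (c j.+1) phi)).
Proof.
(* [m] counts the factors already applied; the induction starts from the empty product at j + 1 =
   n. *)
have [m jE] : exists m, (j + m.+1 = n)%N.
  by exists (n - j.+1)%N; rewrite addnS -addSn subnKC.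
elim: m j jE => [|m IHm] j jE.
  have jn : j.+1 = n by rewrite -addn1.
  have cn : 0 <= c n by rewrite -jn.
  rewrite jn prod_from_empty.
  apply: eqL1_trans (eq_RLint _ _ _ fphi) _; [exact: RLint_L1..|].
  apply: eqL1_trans (RLint_comp cn ler01 phi1) _; rewrite addrC.
  exact/eqL1_sym/RLint_comp.
have jn : (j.+1 < n)%N by rewrite -[X in (_ < X)%N]jE -[ltnLHS]addn1 ltn_add2l.
have H := prod_from_step (IHm (Ordinal jn) (etrans (addSnnS _ _) jE)).
apply: eqL1_trans H _; exact/eqL1_sym/RLint_comp.
Qed.

End LeftInverse.

Theorem theorem3p4 (R : realType) (n : nat) (alpha : R) (gamma : 'rV[R]_n)
    (hn : (1 <= n)%N) (halpha : 0 < alpha <= 1)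
    (hgamma : forall j : 'I_n,
       0 <= gamma 0 j /\ alpha + psum gamma j.+1 <= j.+1%:R) :
  forall f : R -> R, XFT alpha f ->
    X1nL alpha gamma (RLint alpha f) /\
    eqL1 (DnL alpha gamma (RLint alpha f)) f.
Proof.
move=> f [f1 [F [[[phi [phi1 FE]] fF] F0]]].
have a0 : 0 <= alpha by case/andP: halpha => /ltW.
(* The condition [F 0 = 0] removes the constant of integration. *)
have fphi : eqL1 (RLint alpha f) (RLint 1 phi).
  apply: eqL1_trans fF _; apply: eq_in_eqL1 => x x01.
  by rewrite FE// F0 add0r RLint1.
have cP (j : 'I_n) : 0 <= j.+1%:R - alpha - psum gamma j.+1.
  by rewrite -addrA -opprD subr_ge0; case: (hgamma j).
split.
  split; first exact: RLint_L1.
  (* Writing i = k + 2 with k < n matches the indexing of [prod_from_RLint]. *)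
  move=> [|[|k]]// /andP[_]; rewrite ltnS => kn.
  have c1 : L1 (RLint (k.+1%:R - alpha - psum gamma k.+1) phi).
    by apply: RLint_L1 => //; exact: (cP (Ordinal kn)).
  exact: inAC_RLint1 c1 (prod_from_RLint halpha hgamma f1 phi1 fphi (Ordinal kn)).
pose j0 := Ordinal hn.
apply: eqL1_trans (RLint_onem_derivative halpha f1 phi1 fphi).
apply: eqL1_trans (prod_from_step hgamma phi1
  (prod_from_RLint halpha hgamma f1 phi1 fphi j0)) _.
(* After the outermost factor the order is 1 + c_0 = 1 - alpha. *)
by rewrite psum0 subr0 add0r; exact: eqL1_refl.
Qed.
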